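(* Let $n\ge1$ and $m\ge0$ be integers and $x$ an indeterminate. Let $$T_{n,m}(x)=\left[\binom{x+m}{j-i+m}-\binom{x+m}{m-i-j-1}\right]_{i,j=0}^{n-1},\qquad B_{n,m}(x)=\left[\binom{x+m+2i}{i-j+m}-\binom{x+m+2i}{i-j+m-1}\right]_{i,j=0}^{n-1}.$$ Then $\det T_{n,m}(x)=\det B_{n,m}(x)$, and consequently $$\det T_{n,m}(x)=\prod_{i=1}^n\prod_{j=1}^m\frac{(x+i-j)(x+2i+j-2)}{(x+2i-j)(i+j-1)}.$$
   Context: For $z$ an indeterminate and $k$ an integer, $\binom{z}{k}=z(z-1)\cdots(z-k+1)/k!$ if $k\ge0$ and $\binom{z}{k}=0$ if $k<0$. The identities are identities of rational functions in $x$. *)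

(* Defs.v *)
From HB Require Import structures.
From mathcomp Require Import all_boot all_order all_algebra.
Set Implicit Arguments.
Unset Strict Implicit.
Unset Printing Implicit Defensive.
Import GRing.Theory.
Local Open Scope ring_scope.

(* Only meaningful in characteristic 0, where k`! is invertible. *)
Definition gbinom (K : fieldType) (z : K) (k : int) : K :=
  match k with
  | Posz k' => (\prod_(l < k') (z - l%:R)) / (k'`!)%:R
  | Negz _ => 0
  end.

(* All lower arguments are signed: they are computed in int. *)
Definition T_mx (K : fieldType) (n m : nat) (x : K) : 'M[K]_n :=
  \matrix_(i < n, j < n)
    (gbinom (x + m%:R) (j%:Z - i%:Z + m%:Z)
     - gbinom (x + m%:R) (m%:Z - i%:Z - j%:Z - 1)).

Definition B_mx (K : fieldType) (n m : nat) (x : K) : 'M[K]_n :=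
  \matrix_(i < n, j < n)
    (gbinom (x + m%:R + (2 * i)%:R) (i%:Z - j%:Z + m%:Z)
     - gbinom (x + m%:R + (2 * i)%:R) (i%:Z - j%:Z + m%:Z - 1)).

Definition Qx : fieldType := {fraction {poly rat}}.
Definition indet : Qx := tofrac ('X : {poly rat}).

(* Main.v *)
Require Import Defs.
From HB Require Import structures.
From mathcomp Require Import all_boot all_order all_algebra.
From mathcomp Require Import ring zify.
Import GRing.Theory.
Local Open Scope ring_scope.

(** Put [f = (1 + t)^(x + m) t^-m] and [s = t + 2 + t^-1].  Then [B(i, j)] is
    the constant term of [f (1 - t) t^j s^i] and [T(i, j)] that of
    [f (1 - t) t^i (t^-j + ... + t^j)]; since [s^k] is a unitriangular
    combination of the [t^-j + ... + t^j], [B = L T^T] with [L] unitriangular.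

    For the product, [C(z, k) - C(z, k - 1)] is a multiple of [C(z + 1, k)] by
    factors that split into rows and columns, and up to further row factors
    [C(x + m + 1 + 2 i, m + i - j)] is the value at [i] of a polynomial [p_j]
    of degree [n - 1].  By Vandermonde [det (p_j(a_i))] depends only on the
    differences of the [a_i], so [i] may be replaced by [i - m], which makes
    the matrix triangular. *)

(** * Generalized binomial coefficients in characteristic 0 *)

Section Entries.
Variable K : fieldType.
Hypothesis charK0 : [pchar K] =i pred0.

Lemma natrS_neq0 k : k.+1%:R != 0 :> K.
Proof. by rewrite ((pcharf0P K).1 charK0). Qed.

Lemma fact_neq0 k : (k`!)%:R != 0 :> K.
Proof. by rewrite ((pcharf0P K).1 charK0) -lt0n fact_gt0. Qed.

Lemma gbinom_lt0 (z : K) (k : int) : (k < 0)%R -> gbinom z k = 0.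
Proof. by case: k. Qed.

Lemma gbinomS (z : K) (k : nat) :
  gbinom z k.+1 = gbinom z k * (z - k%:R) / k.+1%:R.
Proof.
rewrite /gbinom big_ord_recr /= factS natrM.
by move: (natrS_neq0 k) (fact_neq0 k) => h1 h2; field; rewrite nat1r h1.
Qed.

Lemma gbinom0 (z : K) : gbinom z 0%N = 1.
Proof. by rewrite /gbinom big_ord0 fact0 divr1. Qed.

(** Both sides are [(z + 1) z ... (z - k + 1) / k!]. *)
Lemma gbinom_succ (z : K) (k : nat) :
  (z + 1) * gbinom z k = (z + 1 - k%:R) * gbinom (z + 1) k.
Proof.
elim: k => [|k IHk]; first by rewrite !gbinom0 subr0.
transitivity ((z + 1) * gbinom z k * (z - k%:R) / k.+1%:R).
  by rewrite gbinomS !mulrA.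
by rewrite IHk gbinomS -natr1; field; rewrite natr1 natrS_neq0.
Qed.

Lemma gbinom_pascal (z : K) (k : int) :
  gbinom (z + 1) k = gbinom z k + gbinom z (k - 1).
Proof.
case: k => [[|k]|k]; last by rewrite !gbinom_lt0 ?addr0 //; lia.
  by rewrite !gbinom0 gbinom_lt0 ?addr0.
have -> : k.+1%:Z - 1 = k by lia.
elim: k => [|k IHk].
  by rewrite !gbinomS !gbinom0; field; rewrite oner_neq0.
rewrite gbinomS IHk !(gbinomS z) -!natr1.
have := natrS_neq0 k; have := natrS_neq0 k.+1; rewrite -!natr1 => h1 h2.
by field; rewrite h1 h2.
Qed.

(** By Pascal's rule the left side is [C(z + 1, k) - 2 C(z, k - 1)], and
    [C(z, k - 1) = k / (z + 1) C(z + 1, k)]. *)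
Lemma gbinom_ballot (z : K) (k : int) : z + 1 != 0 ->
  gbinom z k - gbinom z (k - 1) =
  (z + 1 - 2%:R * k%:~R) / (z + 1) * gbinom (z + 1) k.
Proof.
move=> z1; rewrite -(addrK (gbinom z (k - 1)) (gbinom z k)) -gbinom_pascal.
case: k => [k|k]; last by rewrite !gbinom_lt0 ?mulr0 ?subr0 //; lia.
have -> : gbinom z (k%:Z - 1) = k%:R / (z + 1) * gbinom (z + 1) k.
  have : gbinom z (k%:Z - 1) = gbinom (z + 1) k - gbinom z k.
    by rewrite gbinom_pascal; ring.
  move=> ->; apply: (mulfI z1); rewrite mulrBr gbinom_succ.
  by field.
by field.
Qed.

(** * Recurrences for the entries and equality of the determinants *)

Variables (m : nat) (x : K).

(** The indices are integers because the recurrences step to index [-1]. *)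
Definition T_entry (i j : int) : K :=
  gbinom (x + m%:R) (j - i + m%:Z) - gbinom (x + m%:R) (m%:Z - i - j - 1).

Definition B_entry (k : nat) (i : int) : K :=
  gbinom (x + m%:R + (2 * k)%:R) (k%:Z - i + m%:Z)
  - gbinom (x + m%:R + (2 * k)%:R) (k%:Z - i + m%:Z - 1).

(** The first binomial depends only on [j - i], the second only on [i + j], so the terms match in
    pairs. *)
Lemma T_entry_rec i j :
  T_entry (i + 1) j + T_entry (i - 1) j = T_entry i (j + 1) + T_entry i (j - 1).
Proof.
rewrite /T_entry.
have -> : j - (i + 1) + m%:Z = j - 1 - i + m%:Z by ring.
have -> : m%:Z - (i + 1) - j - 1 = m%:Z - i - (j + 1) - 1 by ring.
have -> : j - (i - 1) + m%:Z = j + 1 - i + m%:Z by ring.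
have -> : m%:Z - (i - 1) - j - 1 = m%:Z - i - (j - 1) - 1 by ring.
by ring.
Qed.

Lemma T_entryN1 i : T_entry i (-1) = - T_entry i 0.
Proof.
rewrite /T_entry opprB; congr (gbinom _ _ - gbinom _ _); ring.
Qed.

Lemma B_entry0 i : B_entry 0 i = T_entry i 0.
Proof.
rewrite /B_entry /T_entry muln0 addr0; congr (gbinom _ _ - gbinom _ _); ring.
Qed.

(** Pascal's rule applied twice: raising [k] by one multiplies by [t + 2 + t^-1]. *)
Lemma B_entryS k i :
  B_entry k.+1 i = B_entry k (i + 1) + B_entry k (i - 1) + 2%:R * B_entry k i.
Proof.
rewrite /B_entry.
have -> : x + m%:R + (2 * k.+1)%:R = x + m%:R + (2 * k)%:R + 1 + 1.
  by rewrite mulnS natrD; ring.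
rewrite !gbinom_pascal; move: (x + _ + _) => z.
have -> : k.+1%:Z - i + m%:Z = k%:Z - i + m%:Z + 1 by lia.
have -> : k%:Z - (i - 1) + m%:Z = k%:Z - i + m%:Z + 1 by ring.
have -> : k%:Z - (i + 1) + m%:Z = k%:Z - i + m%:Z - 1 by ring.
by rewrite !addrK; ring.
Qed.

(* Coefficients of [(t + 2 + t^-1) ^ k] in the basis [t^-j + ... + t^j]. *)
Fixpoint ballot (k j : nat) : K :=
  if k is k'.+1 then
    if j is j'.+1 then ballot k' j' + 2%:R * ballot k' j + ballot k' j.+1
    else ballot k' 0 + ballot k' 1
  else (j == 0%N)%:R.

Lemma ballot_gt k j : (k < j)%N -> ballot k j = 0.
Proof.
elim: k j => [|k IHk] [|j] //= lkj.
by rewrite !IHk ?mulr0 ?addr0 //; lia.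
Qed.

Lemma ballot_diag k : ballot k k = 1.
Proof. by elim: k => //= k ->; rewrite !ballot_gt ?mulr0 ?addr0. Qed.

(** Summation by parts moves the recurrence of [ballot] onto [t]. The convention [t(-1) = - t(0)]
    lowers the coefficient 2 to 1 at [j = 0], and [k < n] removes the terms at the upper end. *)
Lemma ballot_sum k n (t : nat -> K) : (k < n)%N ->
  \sum_(j < n.+1) ballot k.+1 j * t j =
  \sum_(j < n.+1) ballot k j *
     (t j.+1 + (if j : nat is j'.+1 then t j' else - t 0%N) + 2%:R * t j).
Proof.
move=> lkn; pose g j := ballot k j.
have g0 j : (k < j)%N -> g j = 0 by apply: ballot_gt.
transitivity ((g 0%N + g 1%N) * t 0%N + (\sum_(j < n) g j * t j.+1 +
    2%:R * (\sum_(j < n) g j.+1 * t j.+1) + \sum_(j < n) g j.+2 * t j.+1)).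
  rewrite big_ord_recl mulr_sumr -!big_split /=; congr (_ + _).
  by apply: eq_bigr => j _; rewrite /g /bump /=; ring.
rewrite (eq_bigr (fun j : 'I_n.+1 => g j * t j.+1 +
    g j * (if j : nat is j'.+1 then t j' else - t 0%N) +
    2%:R * (g j * t j))); last first.
  by move=> j _; rewrite !mulrDr [_ * (2%:R * _)]mulrCA.
rewrite !big_split /= -mulr_sumr.
rewrite [X in _ = X + _ + _]big_ord_recr /= (g0 n) // mul0r addr0.
rewrite [X in _ = _ + X + _]big_ord_recl /=.
rewrite [X in _ = _ + _ * X]big_ord_recl /=.
have -> : \sum_(j < n) g j.+1 * t j =
          g 1%N * t 0%N + \sum_(j < n) g j.+2 * t j.+1.
  transitivity (\sum_(j < n.+1) g j.+1 * t j).
    by rewrite big_ord_recr /= (g0 n.+1) ?mul0r ?addr0 // ltnW.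
  by rewrite big_ord_recl.
by rewrite /bump /=; ring.
Qed.

Lemma B_entryE k n i : (k < n)%N ->
  B_entry k i = \sum_(j < n) ballot k j * T_entry i j%:Z.
Proof.
elim: k n i => [|k IHk] [|n] i // lkn.
  rewrite big_ord_recl /= mul1r B_entry0 big1 ?addr0 // => j _.
  by rewrite mul0r.
rewrite (ballot_sum _ _ (fun j => T_entry i j%:Z)) //.
rewrite B_entryS !(IHk n.+1) ?(ltnW lkn) // mulr_sumr -!big_split /=.
apply: eq_bigr => j _; rewrite mulrCA -!mulrDr T_entry_rec.
congr (_ * (_ + _ + _)); first by congr T_entry; lia.
(* At [j = 0] the value in column [-1] is minus that in column [0], which is the convention of
   [ballot_sum]. *)
case: (j : nat) => [|j']; first by rewrite sub0r T_entryN1.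
by congr T_entry; lia.
Qed.

Lemma det_T_B n : \det (T_mx n m x) = \det (B_mx n m x).
Proof.
pose L : 'M[K]_n := \matrix_(i, j) ballot i j.
have -> : B_mx n m x = L *m (T_mx n m x)^T.
  apply/matrixP => i j; rewrite !mxE -/(B_entry i j%:Z) (B_entryE _ n) //.
  by apply: eq_bigr => k _; rewrite !mxE.
rewrite det_mulmx det_tr det_trig.
  by rewrite big1 ?mul1r // => i _; rewrite mxE ballot_diag.
by apply/is_trig_mxP => i j lij; rewrite mxE ballot_gt.
Qed.

End Entries.

(** * Determinants of polynomial values *)

Section HornerMatrix.
Variable K : comNzRingType.

(** The matrix is a transposed Vandermonde matrix times the coefficient matrix, so the nodes enter
    only through their differences. *)
Lemma det_horner n (p : 'I_n -> {poly K}) (a : 'I_n -> K) :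
  (forall j, (size (p j) <= n)%N) ->
  \det (\matrix_(i, j) (p j).[a i]) =
  \det (\matrix_(k < n, j < n) (p j)`_k) *
  \prod_(i < n) \prod_(j < n | (i < j)%N) (a j - a i).
Proof.
move=> szp; pose v := \row_i a i.
have -> : \matrix_(i, j) (p j).[a i] =
          (Vandermonde n v)^T *m \matrix_(k < n, j < n) (p j)`_k.
  apply/matrixP => i j; rewrite !mxE (horner_coef_wide _ (szp j)).
  by apply: eq_bigr => k _; rewrite !mxE mulrC.
rewrite det_mulmx det_tr det_Vandermonde mulrC; congr (_ * _).
by apply: eq_bigr => i _; apply: eq_bigr => j _; rewrite !mxE.
Qed.

Lemma det_horner_shift n (p : 'I_n -> {poly K}) (a : 'I_n -> K) (c : K) :
  (forall j, (size (p j) <= n)%N) ->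
  \det (\matrix_(i, j) (p j).[a i - c]) = \det (\matrix_(i, j) (p j).[a i]).
Proof.
move=> szp; rewrite (det_horner n p (fun i => a i - c)) // det_horner //.
congr (_ * _); apply: eq_bigr => i _; apply: eq_bigr => j _.
by rewrite opprB addrA subrK.
Qed.

End HornerMatrix.

(** * Rising factorials *)

Section RisingFactorial.
Variable K : comNzRingType.

Definition rfact (z : K) (k : nat) : K := \prod_(l < k) (z + l%:R).

Lemma rfact1 z : rfact z 1 = z.
Proof. by rewrite /rfact big_ord1 addr0. Qed.

Lemma rfactD z a b : rfact z (a + b) = rfact z a * rfact (z + a%:R) b.
Proof.
rewrite /rfact big_split_ord /=; congr (_ * _); apply: eq_bigr => l _.
by rewrite natrD addrA.
Qed.

Lemma rfact_rev z k : \prod_(l < k) (z - l%:R) = rfact (z - k%:R + 1) k.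
Proof.
rewrite /rfact (reindex_inj rev_ord_inj) /=; apply: eq_bigr => l _.
by rewrite natrB // -natr1; ring.
Qed.

(** If [N < k], the factor [l = N] is zero, as is the falling factorial. *)
Lemma prod_natr_ffact (N k : nat) :
  \prod_(l < k) (N%:R - l%:R) = (N ^_ k)%:R :> K.
Proof.
elim: k => [|k IHk]; first by rewrite big_ord0.
rewrite big_ord_recr /= IHk ffactnSr natrM.
have [leNk|ltNk] := leqP k N; first by rewrite natrB.
by rewrite ffact_small // !mul0r.
Qed.

Lemma prod_natr_fact (i k : nat) :
  (\prod_(j < k) (i + j).+1%:R) * (i`!)%:R = ((k + i)`!)%:R :> K.
Proof.
elim: k => [|k IHk]; first by rewrite big_ord0 mul1r.
by rewrite big_ord_recr /= mulrAC IHk addSn factS natrM mulrC addnC.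
Qed.

(** Both sides run over the pairs [i <= l < n], grouped by the smaller index on the left and by the
    larger on the right. *)
Lemma prod_triangle (y : K) n :
  \prod_(i < n) \prod_(i <= l < n) (y + 1 + (i + l)%:R) =
  \prod_(i < n) rfact (y + i%:R + 1) i.+1.
Proof.
elim: n => [|n IHn]; first by rewrite !big_ord0.
rewrite [RHS]big_ord_recr /= -IHn.
transitivity (\prod_(i < n.+1) ((\prod_(i <= l < n) (y + 1 + (i + l)%:R))
                                 * (y + 1 + (i + n)%:R))).
  by apply: eq_bigr => i _; rewrite big_nat_recr // -ltnS.
rewrite big_split big_ord_recr /= big_geq // mulr1; congr (_ * _).
by apply: eq_bigr => i _; rewrite natrD; ring.
Qed.

End RisingFactorial.

Arguments rfact {K} z k.

(** * The product formula, for [x] not the image of an integer *)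

Section ProductFormula.
Variable K : fieldType.
Hypothesis charK0 : [pchar K] =i pred0.
Variables (n m : nat) (x : K).
Hypothesis x_neq_int : forall a b : nat, x + a%:R - b%:R != 0.

Lemma x_neq_nat a : x + a%:R != 0.
Proof. by have := x_neq_int a 0; rewrite subr0. Qed.

Lemma rfact_neq0 a b k : rfact (x + a%:R - b%:R) k != 0.
Proof.
apply/prodf_neq0 => l _.
have -> : x + a%:R - b%:R + l%:R = x + (a + l)%:R - b%:R.
  by rewrite natrD; ring.
exact: x_neq_int.
Qed.

Lemma gbinom_rfact (z : K) (k : nat) :
  gbinom z k = rfact (z - k%:R + 1) k / (k`!)%:R.
Proof. by rewrite -rfact_rev. Qed.

(* [(rpoly j).[i%:R]] is what remains of [C(x + m + 1 + 2 i, m + i - j)] once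
   the factors depending on [i] only are removed. *)
Definition rroots (j : nat) : seq K :=
  [seq l%:R - m%:R | l <- index_iota 0 j] ++
  [seq - (x + 1 + l%:R) | l <- index_iota j.+1 n].

Definition rpoly (j : nat) : {poly K} := \prod_(a <- rroots j) ('X - a%:P).

(** There are [j] roots in the first list and [n - j - 1] in the second. *)
Lemma size_rpoly (j : 'I_n) : (size (rpoly j) <= n)%N.
Proof.
rewrite size_prod_XsubC size_cat !size_map !size_iota.
by have := ltn_ord j; lia.
Qed.

Lemma horner_rpoly j y : (rpoly j).[y] =
  (\prod_(l < j) (y + m%:R - l%:R)) * \prod_(j.+1 <= l < n) (y + x + 1 + l%:R).
Proof.
rewrite horner_prod big_cat !big_map /=; congr (_ * _).
  by rewrite big_mkord; apply: eq_bigr => l _; rewrite hornerXsubC; ring.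
by apply: eq_bigr => l _; rewrite hornerXsubC; ring.
Qed.

(** A denominator common to row [i]: it contains the factors of [rfact (x + i + 2) j] for every
    [j < n]. *)
Definition row_den (i : nat) : K := \prod_(1 <= l < n) (x + 1 + (i + l)%:R).

Lemma row_den_neq0 i : row_den i != 0.
Proof.
rewrite /row_den prodf_seq_neq0; apply/allP => l _ /=.
by rewrite -addrA nat1r x_neq_nat.
Qed.

(** The quotient of the two binomials is [(m + i) ^_ j / rfact (x + i + 2) j]; the factors of
    [row_den i] with [l > j] are those kept in [rpoly j]. *)
Lemma gbinom_rpoly (i j : 'I_n) :
  gbinom (x + m%:R + 1 + (2 * i)%:R) (i%:Z - j%:Z + m%:Z) * row_den i =
  gbinom (x + m%:R + 1 + (2 * i)%:R) (m + i)%:Z * (rpoly j).[i%:R].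
Proof.
rewrite horner_rpoly -natrD prod_natr_ffact (addnC i).
have [lt_j|le_j] := ltnP (m + i) j.
  rewrite ffact_small // mul0r mulr0 gbinom_lt0 ?mul0r //; lia.
have [k Dk] : exists k, (m + i = j + k)%N by exists (m + i - j)%N; lia.
have -> : i%:Z - j%:Z + m%:Z = k by lia.
(* With [m] eliminated, the longer rising factorial splits after [j] factors, and its tail is the
   shorter one. *)
have Dm : m%:R = j%:R + k%:R - i%:R :> K.
  by rewrite -natrD -Dk natrD; ring.
rewrite Dk !gbinom_rfact rfactD.
have -> : row_den i = rfact (x + 2%:R + i%:R) j *
    \prod_(j.+1 <= l < n) (i%:R + x + 1 + l%:R).
  rewrite /row_den (@big_cat_nat _ _ _ j.+1) //=; congr (_ * _).
    rewrite big_add1 big_mkord; apply: eq_bigr => l _.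
    by rewrite natrD -[l.+1%:R]natr1; ring.
  by apply: eq_bigr => l _; rewrite natrD; ring.
rewrite natrM natrD Dm.
have -> : x + (j%:R + k%:R - i%:R) + 1 + 2%:R * i%:R - k%:R + 1 =
          x + 2%:R + i%:R + j%:R by ring.
have -> : x + (j%:R + k%:R - i%:R) + 1 + 2%:R * i%:R - (j%:R + k%:R) + 1 =
          x + 2%:R + i%:R by ring.
have /(congr1 (fun a => a%:R : K)) : ((j + k) ^_ j * k`! = (j + k)`!)%N.
  by rewrite -{2}(addKn j k) ffact_fact // leq_addr.
rewrite natrM => <-.
have : ((j + k) ^_ j)%:R != 0 :> K.
  by rewrite ((pcharf0P K).1 charK0) -lt0n ffact_gt0 leq_addr.
move: (_%:R) (fact_neq0 K charK0 k) => a h1 h2.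
by field; rewrite h1 h2.
Qed.

Definition row_coef (i : nat) : K :=
  gbinom (x + m%:R + 1 + (2 * i)%:R) (m + i)%:Z /
  ((x + m%:R + 1 + (2 * i)%:R) * row_den i).

(** The numerator [z + 1 - 2 k] of [gbinom_ballot] at [z = x + m + 2 i], [k = m + i - j], where [i]
    cancels. *)
Definition col_coef (j : nat) : K := x - m%:R + 1 + (2 * j)%:R.

Lemma B_mx_factor :
  B_mx n m x = diag_mx (\row_(i < n) row_coef i)
     *m (\matrix_(i, j) (rpoly j).[i%:R]) *m diag_mx (\row_(j < n) col_coef j).
Proof.
rewrite mul_diag_mx mul_mx_diag; apply/matrixP => i j; rewrite !mxE.
have z1 : x + m%:R + (2 * i)%:R + 1 != 0.
  by rewrite -!addrA natr1 -natrD x_neq_nat.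
rewrite gbinom_ballot //.
have Dz : x + m%:R + (2 * i)%:R + 1 = x + m%:R + 1 + (2 * i)%:R by ring.
rewrite Dz in z1 *.
rewrite -[gbinom _ _](mulfK (row_den_neq0 i)) gbinom_rpoly /row_coef /col_coef.
have -> : x + m%:R + 1 + (2 * i)%:R - 2%:R * (i%:Z - j%:Z + m%:Z)%:~R =
          x - m%:R + 1 + (2 * j)%:R.
  by rewrite !intrD intrN !natrM -!pmulrn; ring.
move: (row_den i) (row_den_neq0 i) z1 => d d0.
by move: (x + _ + _ + _) => z z1; field; rewrite z1 d0.
Qed.

Lemma det_rpoly :
  \det (\matrix_(i < n, j < n) (rpoly j).[i%:R]) =
  \prod_(i < n) ((i`!)%:R * \prod_(i.+1 <= l < n) (x - m%:R + 1 + (i + l)%:R)).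
Proof.
rewrite -(det_horner_shift K n _ _ m%:R) => [|j]; last exact: size_rpoly.
rewrite det_trig; last first.
  (* At [i - m] with [i < j], the factor [l = i] of the first product vanishes. *)
  apply/is_trig_mxP => i j lij; rewrite mxE horner_rpoly (bigD1 (Ordinal lij)) //=.
  by rewrite subrK subrr !mul0r.
apply: eq_bigr => i _; rewrite mxE horner_rpoly; congr (_ * _).
  by rewrite subrK prod_natr_ffact ffactnn.
by apply: eq_bigr => l _; rewrite natrD; ring.
Qed.

Definition shifted_row (y : K) (i : nat) : K :=
  \prod_(i <= l < n) (y + 1 + (i + l)%:R).

(** Multiplied by [x + i + 1], both [row_den i] and the rising factorial of the binomial begin with
    [rfact (x + i + 1) i], which cancels; the last factor of the latter cancels
    [x + m + 1 + 2 i]. *)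
Lemma row_coefE (i : 'I_n) : row_coef i =
  rfact (x + (2 * i)%:R + 1) m / (((m + i)`!)%:R * shifted_row x i).
Proof.
have W0 : shifted_row x i != 0.
  rewrite /shifted_row prodf_seq_neq0; apply/allP => l _ /=.
  by rewrite -addrA nat1r x_neq_nat.
have D0 := row_den_neq0 i.
have xi0 : x + i%:R + 1 != 0 by rewrite -addrA natr1 x_neq_nat.
have z0 : x + m%:R + 1 + (2 * i)%:R != 0.
  by rewrite -!addrA nat1r -natrD x_neq_nat.
have F0 : ((m + i)`!)%:R != 0 :> K by apply: fact_neq0.
have D1 : (x + i%:R + 1) * row_den i =
          rfact (x + i%:R + 1) i * shifted_row x i.
  transitivity (\prod_(0 <= l < n) (x + 1 + (i + l)%:R)).
    rewrite big_ltn ?addn0 ?(leq_ltn_trans _ (ltn_ord i)) //; congr (_ * _).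
    by ring.
  rewrite (@big_cat_nat _ _ _ i) //=; last exact: ltnW.
  by rewrite big_mkord; congr (_ * _); apply: eq_bigr => l _; rewrite natrD; ring.
have D2 : (x + i%:R + 1) * rfact (x + i%:R + 1 + 1) (m + i) =
  rfact (x + i%:R + 1) i * rfact (x + (2 * i)%:R + 1) m *
  (x + m%:R + 1 + (2 * i)%:R).
  have -> : (x + i%:R + 1) * rfact (x + i%:R + 1 + 1) (m + i) =
     rfact (x + i%:R + 1) (1 + (m + i)).
    by rewrite [RHS]rfactD rfact1.
  have -> : (1 + (m + i) = i + m + 1)%N by lia.
  rewrite !rfactD rfact1 natrD mul2n -addnn natrD.
  by congr (_ * rfact _ _ * _); ring.
have R0 : rfact (x + i%:R + 1) i != 0.
  by have := rfact_neq0 i.+1 0 i; rewrite subr0 -natr1 addrA.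
rewrite /row_coef gbinom_rfact.
have -> : x + m%:R + 1 + (2 * i)%:R - (m + i)%:R + 1 = x + i%:R + 1 + 1.
  by rewrite natrM natrD; ring.
have -> : row_den i = rfact (x + i%:R + 1) i * shifted_row x i / (x + i%:R + 1).
  by rewrite -D1 mulrC mulKf.
have -> : rfact (x + i%:R + 1 + 1) (m + i) =
  rfact (x + i%:R + 1) i * rfact (x + (2 * i)%:R + 1) m *
  (x + m%:R + 1 + (2 * i)%:R) / (x + i%:R + 1).
  by rewrite -D2 mulrC mulKf.
move: (x + m%:R + _ + _) (x + i%:R + 1) (shifted_row x i) (((m + i)`!)%:R)
  (rfact _ i) (rfact _ m) z0 xi0 W0 F0 R0 {D0 D1 D2}.
move=> z y w f r r' z0 y0 w0 f0 r0.
by field; rewrite z0 y0 w0 f0 r0.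
Qed.

Lemma det_B_rfact : \det (B_mx n m x) =
  \prod_(i < n) (rfact (x + (2 * i)%:R + 1) m * (i`!)%:R / ((m + i)`!)%:R) *
  \prod_(i < n) (rfact (x - m%:R + i%:R + 1) i.+1 / rfact (x + i%:R + 1) i.+1).
Proof.
rewrite B_mx_factor !det_mulmx !det_diag det_rpoly.
rewrite [X in _ = _ * X]prodf_div -!prod_triangle -prodf_div -!big_split /=.
(* After regrouping by [prod_triangle] the factors agree for each [i]; the term [l = i] split off
   here is [col_coef i]. *)
apply: eq_bigr => i _; rewrite !mxE row_coefE [in RHS]big_ltn // addnn -mul2n.
by rewrite invfM /col_coef -/(shifted_row x i); ring.
Qed.

(** Both sides are [rfact (z - a) (a + b)], split after [a] and after [b] factors. *)
Lemma rfact_shift (z : K) a b :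
  rfact (z - a%:R) a * rfact z b =
  rfact (z - a%:R) b * rfact (z + b%:R - a%:R) a.
Proof.
have := rfactD K (z - a%:R) a b; rewrite subrK => <-.
by rewrite addnC rfactD; congr (_ * rfact _ _); ring.
Qed.

Lemma det_B_prod : \det (B_mx n m x) =
  \prod_(1 <= i < n.+1) \prod_(1 <= j < m.+1)
    (((x + i%:R - j%:R) * (x + (2 * i)%:R + j%:R - 2%:R))
     / ((x + (2 * i)%:R - j%:R) * (i + j - 1)%:R)).
Proof.
rewrite det_B_rfact -big_split /= [RHS]big_add1 big_mkord.
apply: eq_bigr => i _; rewrite [RHS]big_add1 big_mkord /=.
rewrite prodf_div !big_split /=.
have -> : \prod_(j < m) (x + i.+1%:R - j.+1%:R) = rfact (x + i%:R + 1 - m%:R) m.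
  rewrite addrAC -rfact_rev; apply: eq_bigr => j _.
  by rewrite -!natr1; ring.
have -> : \prod_(j < m) (x + (2 * i.+1)%:R + j.+1%:R - 2%:R) =
          rfact (x + (2 * i)%:R + 1) m.
  by apply: eq_bigr => j _; rewrite mulnS natrD -[j.+1%:R]natr1; ring.
have -> : \prod_(j < m) (x + (2 * i.+1)%:R - j.+1%:R) =
          rfact (x + i%:R + 1 + i.+1%:R - m%:R) m.
  have -> : x + i%:R + 1 + i.+1%:R - m%:R = x + (2 * i)%:R + 1 - m%:R + 1.
    by rewrite natrM -natr1; ring.
  rewrite -rfact_rev; apply: eq_bigr => j _.
  by rewrite mulnS natrD -[j.+1%:R]natr1; ring.
have -> : \prod_(j < m) (i.+1 + j.+1 - 1)%:R = ((m + i)`!)%:R / (i`!)%:R :> K.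
  rewrite -prod_natr_fact mulfK ?fact_neq0 //.
  by apply: eq_bigr => j _; congr (_%:R); lia.
(* Trades the two rising factorials of length [i + 1] for two of length [m], matching the products
   over [j]. *)
have S := rfact_shift (x + i%:R + 1) m i.+1.
have R1 : rfact (x + i%:R + 1) i.+1 != 0.
  by have := rfact_neq0 i.+1 0 i.+1; rewrite subr0 -natr1 addrA.
have R2 : rfact (x + i%:R + 1 + i.+1%:R - m%:R) m != 0.
  have := rfact_neq0 (i.+1 + i.+1) m m.
  by rewrite natrD -{1}natr1 !addrA.
have -> : rfact (x + i%:R + 1 - m%:R) m =
   rfact (x + i%:R + 1 - m%:R) i.+1 *
   rfact (x + i%:R + 1 + i.+1%:R - m%:R) m / rfact (x + i%:R + 1) i.+1.
  by rewrite -S mulfK.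
have -> : x - m%:R + i%:R + 1 = x + i%:R + 1 - m%:R by ring.
move: (fact_neq0 K charK0 i) (fact_neq0 K charK0 (m + i)).
move: R1 R2 {S}; move: (rfact (x + i%:R + 1) _) (rfact (_ + i.+1%:R - _) _).
move: (rfact _ m) (rfact _ i.+1) (i`!%:R) ((m + i)`!%:R).
move=> a b c d e f e0 f0 c0 d0.
by field; rewrite c0 d0 e0 f0.
Qed.

End ProductFormula.

(** * Specialization to the field of rational functions *)

Lemma pchar_Qx : [pchar Qx] =i pred0.
Proof.
apply/pcharf0P => k.
rewrite -(rmorph_nat (@tofrac {poly rat})) tofrac_eq0 -(rmorph_nat (@polyC rat)).
by rewrite polyC_eq0 Num.Theory.pnatr_eq0.
Qed.

(** It is the image of a polynomial of degree 1. *)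
Lemma indet_neq_int (a b : nat) : indet + a%:R - b%:R != 0.
Proof.
rewrite -!(rmorph_nat (@tofrac {poly rat})) -rmorphD -rmorphB tofrac_eq0 /=.
rewrite -addrA -!(rmorph_nat (@polyC rat)) -rmorphB /=.
by rewrite -size_poly_eq0 size_XaddC.
Qed.

Theorem theorem2 (n m : nat) (hn : (1 <= n)%N) :
  \det (T_mx n m indet) = \det (B_mx n m indet) /\
  \det (T_mx n m indet) =
    \prod_(1 <= i < n.+1) \prod_(1 <= j < m.+1)
      (((indet + i%:R - j%:R) * (indet + (2 * i)%:R + j%:R - 2%:R))
       / ((indet + (2 * i)%:R - j%:R) * (i + j - 1)%:R)).
Proof.
rewrite (det_T_B _ pchar_Qx); split=> //.
exact: (det_B_prod _ pchar_Qx _ _ _ indet_neq_int).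
Qed.
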